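(* Let $d\ge 0$ be an integer and let $S(2,d)$ be the Schur algebra over $\mathbb{Q}$ (defined in the context). Then $S(2,d)$ is isomorphic with the associative $\mathbb{Q}$-algebra with $1$ generated by $e,f,H_2$ subject to the relations $$H_2e-eH_2=-e,\qquad ef-fe=d-2H_2,\qquad H_2f-fH_2=f,$$ $$H_2(H_2-1)\cdots(H_2-d)=0.$$ Moreover, this presented algebra has a $\mathbb{Q}$-basis consisting of all $f^a H_2^b e^c$ with $a,b,c$ nonnegative integers such that $a+b+c\le d$.
   Context: Let $E$ be a $2$-dimensional $\mathbb{Q}$-vector space with fixed basis $e_1,e_2$, identifying $GL(E)$ with $GL_2(\mathbb{Q})$. The group $GL_2(\mathbb{Q})$ acts diagonally on $E^{\otimes d}$; extending linearly gives a representation of the group algebra $\mathbb{Q}GL_2(\mathbb{Q})\to\mathrm{End}(E^{\otimes d})$, and the Schur algebra $S(2,d)$ is its image. Equivalently, $S(2,d)$ is the image of the differentiated representation $\rho_d:U(\mathfrak{gl}_2)\to\mathrm{End}(E^{\otimes d})$ of the universal enveloping algebra. *)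

(* Defs.v *)
From HB Require Import structures.
From mathcomp Require Import all_boot all_order all_algebra.
Set Implicit Arguments. Unset Strict Implicit. Unset Printing Implicit Defensive.
Import Order.TTheory GRing.Theory Num.Theory.
Local Open Scope ring_scope.

(* E^{(x)d} has basis e_{i_1} (x) ... (x) e_{i_d}, i_k in {0,1} (0 <-> e_1,
   1 <-> e_2); the basis vector with index i : 'I_(2^d) is the one whose
   k-th tensor factor is given by the k-th binary digit of i. *)
Definition digit (d : nat) (i : 'I_(2 ^ d)) (k : 'I_d) : 'I_2 :=
  inord ((i %/ 2 ^ k) %% 2).

Definition tensor_rep (d : nat) (g : 'M[rat]_2) : 'M[rat]_(2 ^ d) :=
  \matrix_(i, j) \prod_(k < d) g (digit i k) (digit j k).

(* The Schur algebra S(2,d): image of Q GL_2(Q) in End(E^{(x)d}),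
   i.e. the finite Q-linear combinations of the tensor_rep g, g invertible. *)
Definition in_schur (d : nat) (A : 'M[rat]_(2 ^ d)) : Prop :=
  exists (n : nat) (c : 'I_n -> rat) (g : 'I_n -> 'M[rat]_2),
    (forall t, g t \in unitmx) /\ A = \sum_(t < n) c t *: tensor_rep d (g t).

(* Matrix powers (2^d is not syntactically a successor). *)
Definition mxpow (n : nat) (A : 'M[rat]_n) (k : nat) : 'M[rat]_n :=
  iter k (mulmx A) 1%:M.

Definition mx_rels (d : nat) (e f H : 'M[rat]_(2 ^ d)) : Prop :=
  [/\ H *m e - e *m H = - e,
      e *m f - f *m e = (d%:R)%:M - 2%:R *: H,
      H *m f - f *m H = f &
      foldr (fun i acc => (H - (i%:R)%:M) *m acc) 1%:M (iota 0 d.+1) = 0].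

Definition alg_rels (d : nat) (B : algType rat) (e f H : B) : Prop :=
  [/\ H * e - e * H = - e,
      e * f - f * e = d%:R - 2%:R * H,
      H * f - f * H = f &
      \prod_(i < d.+1) (H - i%:R) = 0].

Definition schur_hom (d : nat) (B : algType rat) (phi : 'M[rat]_(2 ^ d) -> B)
  : Prop :=
  [/\ phi 1%:M = 1,
      forall A C, in_schur A -> in_schur C -> phi (A + C) = phi A + phi C,
      forall (a : rat) A, in_schur A -> phi (a *: A) = a *: phi A &
      forall A C, in_schur A -> in_schur C -> phi (A *m C) = phi A * phi C].

Definition mono (d : nat) (e f H : 'M[rat]_(2 ^ d)) (a b c : nat) :=
  mxpow f a *m mxpow H b *m mxpow e c.

Definition mono_comb (d : nat) (e f H : 'M[rat]_(2 ^ d))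
  (k : 'I_d.+1 -> 'I_d.+1 -> 'I_d.+1 -> rat) : 'M[rat]_(2 ^ d) :=
  \sum_(a < d.+1) \sum_(b < d.+1) \sum_(c < d.+1 | (a + b + c <= d)%N)
     k a b c *: mono e f H a b c.

(* Main.v *)
Require Import Defs.
From HB Require Import structures.
From mathcomp Require Import all_boot all_order all_algebra.
From mathcomp Require Import ring zify.
From Stdlib Require Import ClassicalEpsilon.
Set Implicit Arguments. Unset Strict Implicit. Unset Printing Implicit Defensive.
Import Order.TTheory GRing.Theory Num.Theory.
Local Open Scope ring_scope.

(* In an algebra B satisfying the relations, let W be the span of the monomials
   y^a h^b x^c with a + b + c <= d. Commuting with x or y does not raise the
   degree, so W is stable under ad x and ad y; and W contains every p(h), by
   reduction modulo h(h-1)...(h-d). Since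
     [x, p(h) x^c] = (p(h+1) - p(h)) x^(c+1),
     [y^a p(h) x^c, y] = y^(a+1) (p(h+1) - p(h)) x^c + y^a q(h) x^(c-1)
   and p |-> p(X+1) - p(X) is onto in characteristic 0, W contains all
   y^a p(h) x^c, hence is a subalgebra.
   In End(E^{(x)d}) the monomials of degree <= d are independent: the entries
   of f^a H^b e^c between basis vectors indexed by subsets of {1..d} are
   triangular in c, with Vandermonde blocks. They span S(2,d): a matrix g is a
   product of unipotents, acting by exp(t e) and exp(t f), and of a diagonal
   matrix, acting by a function of H; conversely e, f, H are recovered from these
   one-parameter families by inverting a Vandermonde matrix.
   Applied to B x End(E^{(x)d}), the first part shows that the span of the pairs
   of corresponding monomials is a subalgebra; by independence it is the graph of
   the induced morphism S(2,d) -> B. *)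

(** * Straightening monomials *)

Definition shift_diff (p : {poly rat}) : {poly rat} := p \Po ('X + 1) - p.

Lemma shift_diffD p q : shift_diff (p + q) = shift_diff p + shift_diff q.
Proof. by rewrite /shift_diff comp_polyD; ring. Qed.

Lemma shift_diffZ a p : shift_diff (a *: p) = a *: shift_diff p.
Proof. by rewrite /shift_diff comp_polyZ scalerBr. Qed.

(** The leading terms of p(X+1) and p cancel, so the degree drops. *)
Lemma size_shift_diff n (p : {poly rat}) : (size p <= n.+1)%N -> (size (shift_diff p) <= n)%N.
Proof.
move=> sp; have sX : size ('X + 1 : {poly rat}) = 2 by rewrite size_XaddC.
have [->|p0] := eqVneq p 0; first by rewrite /shift_diff comp_poly0 subr0 size_poly0.
have sc := size_comp_poly2 p sX.
apply/leq_sizeP => j nj; rewrite coefB.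
have [jsp|jsp] := leqP (size p) j.
  by rewrite !nth_default ?subrr // sc.
have ->: j = (size p).-1.
  by apply/eqP; rewrite eqn_leq -ltnS prednK ?jsp ?size_poly_gt0 //= -ltnS prednK
    ?size_poly_gt0 // (leq_trans sp).
rewrite -{1}sc -/(lead_coef (p \Po _)) -/(lead_coef p) lead_coef_comp ?sX //.
by rewrite lead_coefXaddC expr1n mulr1 subrr.
Qed.

Lemma coef_shift_diffXn n : (shift_diff 'X^(n.+1))`_n = n.+1%:R.
Proof.
rewrite /shift_diff comp_Xn_poly coefB coefXn ltn_eqF ?leqnn // subr0.
have nP : (n < n.+2)%N by [].
rewrite addrC exprDn coef_sum (bigD1 (Ordinal nP)) //= expr1n mul1r coefMn coefXn eqxx.
rewrite binSn big1 ?addr0 // => i ni; rewrite expr1n mul1r coefMn coefXn.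
have -> : (n == i)%N = false by apply/negP => /eqP E; case/eqP: ni; apply: val_inj.
exact: mul0rn.
Qed.

Lemma shift_diff_surj q : exists p, shift_diff p = q.
Proof.
have [n] := ubnP (size q); elim: n q => // n IH q; rewrite ltnS => sq.
case: n => [|n] in IH sq *.
  by exists 0; apply/esym/eqP; rewrite /shift_diff comp_poly0 subr0 -size_poly_leq0.
(* The difference of X^(n+1) has coefficient n+1 at X^n, so subtracting that of [p0] removes the
   term of degree n of [q]. The division by n+1 is where characteristic 0 enters. *)
pose p0 := (q`_n / n.+1%:R) *: 'X^(n.+1) : {poly rat}.
case: (IH (q - shift_diff p0)) => [|p Hp].
  rewrite ltnS; apply/leq_sizeP => j; rewrite leq_eqVlt => /predU1P[<-|nj].
    rewrite coefB shift_diffZ coefZ coef_shift_diffXn divfK ?subrr //.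
    by rewrite pnatr_eq0.
  rewrite coefB !nth_default ?subrr //; last exact: leq_trans sq nj.
  apply: leq_trans nj; apply: size_shift_diff.
  by rewrite (leq_trans (size_scale_leq _ _)) // size_polyXn.
by exists (p + p0); rewrite shift_diffD Hp subrK.
Qed.

(** * Commutation rules and the span of the monomials of degree at most d *)

Section Straightening.
Variables (d : nat) (B : algType rat) (x y h : B).

Definition amono a b c : B := y ^+ a * h ^+ b * x ^+ c.

Definition acomb (k : 'I_d.+1 -> 'I_d.+1 -> 'I_d.+1 -> rat) : B :=
  \sum_(a < d.+1) \sum_(b < d.+1) \sum_(c < d.+1 | (a + b + c <= d)%N)
     k a b c *: amono a b c.

Definition spanned (w : B) : Prop := exists k, w = acomb k.

Lemma acombD k l : acomb (fun a b c => k a b c + l a b c) = acomb k + acomb l.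
Proof.
rewrite /acomb -big_split; apply: eq_bigr => a _; rewrite -big_split.
apply: eq_bigr => b _; rewrite -big_split; apply: eq_bigr => c _.
by rewrite scalerDl.
Qed.

Lemma acombZ r k : acomb (fun a b c => r * k a b c) = r *: acomb k.
Proof.
rewrite /acomb scaler_sumr; apply: eq_bigr => a _; rewrite scaler_sumr.
apply: eq_bigr => b _; rewrite scaler_sumr; apply: eq_bigr => c _.
by rewrite scalerA.
Qed.

Lemma spannedD u v : spanned u -> spanned v -> spanned (u + v).
Proof. by move=> [k ->] [l ->]; eexists; rewrite -acombD. Qed.

Lemma spannedZ r u : spanned u -> spanned (r *: u).
Proof. by move=> [k ->]; eexists; rewrite -acombZ. Qed.

Lemma spanned0 : spanned 0.
Proof. by rewrite -(scale0r (acomb (fun _ _ _ => 0))); apply: spannedZ; eexists. Qed.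

Lemma spannedB u v : spanned u -> spanned v -> spanned (u - v).
Proof. by move=> Hu Hv; rewrite -scaleN1r; apply/spannedD/spannedZ. Qed.

Lemma spanned_sum I (r : seq I) (P : pred I) (F : I -> B) :
  (forall i, P i -> spanned (F i)) -> spanned (\sum_(i <- r | P i) F i).
Proof. by move=> HF; apply: big_ind => //; [apply: spanned0 | apply: spannedD]. Qed.

Lemma spanned_mono a b c : (a + b + c <= d)%N -> spanned (amono a b c).
Proof.
move=> abc.
have ltd m : (m <= a + b + c)%N -> (m < d.+1)%N by move=> H; rewrite ltnS (leq_trans H).
have Ha : (a < d.+1)%N by apply: ltd; lia.
have Hb : (b < d.+1)%N by apply: ltd; lia.
have Hc : (c < d.+1)%N by apply: ltd; lia.
exists (fun a' b' c' => ((a' == a :> nat) && (b' == b :> nat) && (c' == c :> nat))%:R).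
rewrite /acomb (bigD1 (Ordinal Ha)) //= [X in _ + X]big1 ?addr0; last first.
  move=> i; rewrite -val_eqE /= => /negPf->.
  by rewrite big1 // => j _; rewrite big1 // => l _; rewrite scale0r.
rewrite (bigD1 (Ordinal Hb)) //= [X in _ + X]big1 ?addr0; last first.
  move=> i; rewrite -val_eqE /= => /negPf->.
  by rewrite big1 // => j _; rewrite andbF scale0r.
rewrite (bigD1 (Ordinal Hc)) //= [X in _ + X]big1 ?addr0.
  by rewrite !eqxx scale1r.
move=> i /andP[_]; rewrite -val_eqE /= => /negPf->.
by rewrite andbF scale0r.
Qed.

Local Notation hp := (horner_alg h).
(** With an arbitrary polynomial in the middle, moving x or y across it becomes the substitution X
    := X+1. *)
Definition pmono a (p : {poly rat}) c : B := y ^+ a * hp p * x ^+ c.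

Lemma pmonoD a p q c : pmono a (p + q) c = pmono a p c + pmono a q c.
Proof. by rewrite /pmono rmorphD mulrDr mulrDl. Qed.

Lemma horner_hZ r p : hp (r *: p) = r *: hp p.
Proof. by rewrite -mul_polyC rmorphM /= horner_algC mulr_algl. Qed.

Lemma pmonoZ a r p c : pmono a (r *: p) c = r *: pmono a p c.
Proof. by rewrite /pmono horner_hZ -scalerAr -scalerAl. Qed.

Lemma pmonoB a p q c : pmono a (p - q) c = pmono a p c - pmono a q c.
Proof. by rewrite pmonoD -scaleN1r pmonoZ scaleN1r. Qed.

Lemma pmonoXn a b c : pmono a 'X^b c = amono a b c.
Proof. by rewrite /pmono rmorphXn /= horner_algX. Qed.

(** For nonzero p, [size p] is the degree plus one, so the bound says that the total degree is at
    most d. *)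
Lemma spanned_pmono_low a (p : {poly rat}) c : (size p + a + c <= d.+1)%N -> spanned (pmono a p c).
Proof.
move=> s; rewrite -[p]coefK poly_def.
rewrite (big_morph (fun p => pmono a p c) (fun p q => pmonoD a p q c) (id1 := 0)); last first.
  by rewrite -(scale0r 0) pmonoZ scale0r.
apply: spanned_sum => i _; rewrite pmonoZ pmonoXn; apply/spannedZ/spanned_mono.
by have := ltn_ord i; lia.
Qed.

Hypothesis rels : alg_rels d x y h.

Lemma horner_h_y p : hp p * y = y * hp (p \Po ('X + 1)).
Proof.
case: rels => _ _ hy _.
elim/poly_ind: p => [|p c IH]; first by rewrite comp_poly0 rmorph0 mul0r mulr0.
rewrite comp_polyD comp_polyM comp_polyX comp_polyC !rmorphD !rmorphM /= !rmorphD.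
rewrite rmorph1 /= !horner_algX horner_algC mulrDl mulrDr -!mulrA.
have -> : h * y = y * (h + 1) by rewrite mulrDr mulr1 -[X in _ = _ + X]hy addrC subrK.
rewrite [X in X + _]mulrA IH; congr (_ + _); first by rewrite !mulrA.
by rewrite -scalerAl -scalerAr mul1r mulr1.
Qed.

Lemma x_horner_h p : x * hp p = hp (p \Po ('X + 1)) * x.
Proof.
case: rels => hx _ _ _.
elim/poly_ind: p => [|p c IH]; first by rewrite comp_poly0 rmorph0 mul0r mulr0.
rewrite comp_polyD comp_polyM comp_polyX comp_polyC !rmorphD !rmorphM /= !rmorphD.
rewrite rmorph1 /= !horner_algX horner_algC mulrDl mulrDr mulrA IH -!mulrA.
have -> : x * h = (h + 1) * x.
  by rewrite mulrDl mul1r -[X in _ + X]opprK -hx opprB addrC subrK.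
by congr (_ + _); rewrite -scalerAl -scalerAr mul1r mulr1.
Qed.

(** The sum of d - 2(X+j) over 0 <= j <= a: the polynomial q of the sl_2 identity [x, y^(a+1)] = y^a
    q(h), and likewise of [x^(a+1), y] = q(h) x^a. *)
Definition weight_poly (a : nat) : {poly rat} := a.+1%:R * (d%:R - a%:R - 2%:R * 'X).

Lemma x_y : x * y = y * x + hp (weight_poly 0).
Proof.
case: rels => _ xy _ _; rewrite /weight_poly !(rmorphM, rmorphB) /= horner_algX.
by rewrite !rmorph_nat mul1r subr0 -xy addrC subrK.
Qed.

Lemma x_yn a : x * y ^+ a.+1 = y ^+ a.+1 * x + y ^+ a * hp (weight_poly a).
Proof.
elim: a => [|a IH]; first by rewrite expr1 expr0 mul1r x_y.
rewrite exprSr mulrA IH mulrDl -!mulrA x_y horner_h_y mulrDr -addrA mulrA -exprSr.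
congr (_ + _); rewrite [y ^+ a * _]mulrA -exprSr -mulrDr -rmorphD; congr (_ * hp _).
rewrite /weight_poly comp_polyM !comp_polyB comp_polyM comp_polyX !rmorph_nat.
by rewrite !mulrSr; ring.
Qed.

Lemma xn_y c : x ^+ c.+1 * y = y * x ^+ c.+1 + hp (weight_poly c) * x ^+ c.
Proof.
elim: c => [|c IH]; first by rewrite expr1 expr0 mulr1 x_y.
rewrite exprS -mulrA IH mulrDr !mulrA x_y x_horner_h mulrDl -addrA -mulrA -exprS.
congr (_ + _); rewrite -[X in _ + X]mulrA -exprS -mulrDl -rmorphD; congr (hp _ * _).
rewrite /weight_poly comp_polyM !comp_polyB comp_polyM comp_polyX !rmorph_nat.
by rewrite !mulrSr; ring.
Qed.

Lemma size_weight_poly (p : {poly rat}) a : (size (p * weight_poly a)%R <= (size p).+1)%N.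
Proof.
have [->|p0] := eqVneq p 0; first by rewrite mul0r size_poly0.
apply: leq_trans (size_polyMleq _ _) _.
suff: (size (weight_poly a) <= 2)%N by lia.
rewrite /weight_poly mulr_natl -scaler_nat (leq_trans (size_scale_leq _ _)) //.
rewrite -!polyC_natr -polyCB (leq_trans (size_polyD _ _)) // geq_max size_polyN.
rewrite (leq_trans (size_polyC_leq1 _)) //= mul_polyC.
by rewrite (leq_trans (size_scale_leq _ _)) // size_polyX.
Qed.

Lemma x_pmono a p c :
  x * pmono a p c = pmono a (p \Po ('X + 1)) c.+1
                    + (if a is a'.+1 then pmono a' (p * weight_poly a') c else 0).
Proof.
case: a => [|a]; rewrite /pmono.
  by rewrite expr0 !mul1r addr0 mulrA x_horner_h -mulrA -exprS.
rewrite [p * _]mulrC rmorphM !mulrA x_yn !mulrDl; congr (_ + _).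
by rewrite -[_ * x * hp p]mulrA x_horner_h [x ^+ c.+1]exprS !mulrA.
Qed.

Lemma pmono_x a p c : pmono a p c * x = pmono a p c.+1.
Proof. by rewrite /pmono -mulrA -exprSr. Qed.

Lemma pmono_y a p c :
  pmono a p c * y = pmono a.+1 (p \Po ('X + 1)) c
                    + (if c is c'.+1 then pmono a (p * weight_poly c') c' else 0).
Proof.
case: c => [|c]; rewrite /pmono.
  by rewrite expr0 !mulr1 addr0 -mulrA horner_h_y mulrA -exprSr.
rewrite rmorphM -!mulrA xn_y !mulrDr; congr (_ + _).
by rewrite [hp p * _]mulrA horner_h_y !mulrA [y ^+ a.+1]exprSr.
Qed.

Lemma y_pmono a p c : y * pmono a p c = pmono a.+1 p c.
Proof. by rewrite /pmono !mulrA -exprS. Qed.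

(** In the bracket only the difference of p survives in the first term: a degree of p is traded for
    a power of x. In the second term a power of y is traded for at most one degree of p. Hence the
    total degree does not grow. *)
Lemma ad_x_pmono a p c :
  x * pmono a p c - pmono a p c * x = pmono a (shift_diff p) c.+1
                    + (if a is a'.+1 then pmono a' (p * weight_poly a') c else 0).
Proof.
rewrite x_pmono pmono_x addrAC; congr (_ + _).
by rewrite /shift_diff pmonoB.
Qed.

Lemma ad_y_pmono a p c :
  pmono a p c * y - y * pmono a p c = pmono a.+1 (shift_diff p) c
                    + (if c is c'.+1 then pmono a (p * weight_poly c') c' else 0).
Proof.
rewrite pmono_y y_pmono addrAC; congr (_ + _).
by rewrite /shift_diff pmonoB.
Qed.

Lemma spanned_ind (P : B -> Prop) :
  P 0 -> (forall u v, P u -> P v -> P (u + v)) -> (forall r u, P u -> P (r *: u)) ->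
  (forall a b c, (a + b + c <= d)%N -> P (amono a b c)) ->
  forall w, spanned w -> P w.
Proof.
move=> P0 PD PZ PM _ [k ->]; rewrite /acomb.
apply: big_ind => // a _; apply: big_ind => // b _; apply: big_ind => // c abc.
exact/PZ/PM.
Qed.

Lemma spanned_ad_x w : spanned w -> spanned (x * w - w * x).
Proof.
move: w; apply: spanned_ind => [|u v|r u|a b c abc].
- by rewrite mulr0 mul0r subrr; apply: spanned0.
- by move=> Hu Hv; rewrite mulrDr mulrDl opprD addrACA; apply: spannedD.
- by move=> Hu; rewrite -scalerAr -scalerAl -scalerBr; apply: spannedZ.
rewrite -pmonoXn ad_x_pmono; apply: spannedD.
  apply: spanned_pmono_low.
  by have := @size_shift_diff b 'X^b; rewrite size_polyXn leqnn => /(_ isT); lia.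
case: a abc => [|a] abc; first exact: spanned0.
apply: spanned_pmono_low.
by have := size_weight_poly 'X^b a; rewrite size_polyXn; lia.
Qed.

Lemma spanned_ad_y w : spanned w -> spanned (w * y - y * w).
Proof.
move: w; apply: spanned_ind => [|u v|r u|a b c abc].
- by rewrite mulr0 mul0r subrr; apply: spanned0.
- by move=> Hu Hv; rewrite mulrDr mulrDl opprD addrACA; apply: spannedD.
- by move=> Hu; rewrite -scalerAr -scalerAl -scalerBr; apply: spannedZ.
rewrite -pmonoXn ad_y_pmono; apply: spannedD.
  apply: spanned_pmono_low.
  by have := @size_shift_diff b 'X^b; rewrite size_polyXn leqnn => /(_ isT); lia.
case: c abc => [|c] abc; first exact: spanned0.
apply: spanned_pmono_low.
by have := size_weight_poly 'X^b c; rewrite size_polyXn; lia.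
Qed.

Lemma spanned_horner_h p : spanned (hp p).
Proof.
(* P is monic of degree d+1 and annihilates h, so p(h) equals r(h) for the remainder r, of degree at
   most d. *)
pose P : {poly rat} := \prod_(i < d.+1) ('X - i%:R%:P).
have Pm : P \is monic by apply: monic_prod_XsubC.
have P0 : hp P = 0.
  case: rels => _ _ _ <-; rewrite rmorph_prod; apply: eq_bigr => i _.
  by rewrite rmorphB /= horner_algX polyC_natr rmorph_nat.
rewrite (Pdiv.IdomainMonic.divp_eq Pm p) rmorphD rmorphM /= P0 mulr0 add0r.
have -> : hp (p %% P) = pmono 0 (p %% P) 0 by rewrite /pmono mul1r mulr1.
apply: spanned_pmono_low; rewrite !addn0.
have sP : size P = d.+2 by rewrite size_prod_XsubC /index_enum -enumT size_enum_ord.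
by rewrite -ltnS -sP ltn_modp monic_neq0.
Qed.

(** Induction on c: writing q as the difference of p, the element q(h) x^(c+1) is the bracket of x
    with p(h) x^c. *)
Lemma spanned_horner_h_xn p c : spanned (pmono 0 p c).
Proof.
elim: c p => [|c IH] q; first by rewrite /pmono mul1r mulr1; apply: spanned_horner_h.
have [p <-] := shift_diff_surj q.
by have := spanned_ad_x (IH p); rewrite ad_x_pmono addr0.
Qed.

Lemma spanned_pmono a p c : spanned (pmono a p c).
Proof.
elim: a c p => [|a IH] c q; first exact: spanned_horner_h_xn.
have [p <-] := shift_diff_surj q.
have := spanned_ad_y (IH c p); rewrite ad_y_pmono.
case: c => [|c]; first by rewrite addr0.
(* The correction term has only a factors y, so the induction hypothesis on a, stated for all c and
   p, covers it. *)
by move=> H; have := spannedB H (IH c (p * weight_poly c)); rewrite addrK.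
Qed.

Lemma h_yn a : h * y ^+ a = y ^+ a * (h + a%:R).
Proof.
case: rels => _ _ hy _.
elim: a => [|a IH]; first by rewrite mulr1 mul1r addr0.
rewrite exprSr mulrA IH -!mulrA; congr (_ * _); rewrite mulrDl mulrDr.
have -> : h * y = y * h + y by rewrite -[X in _ = _ + X]hy addrC subrK.
by rewrite -addrA -natr1 mulrDr mulr1 [_ + y]addrC mulr_natl mulr_natr.
Qed.

Lemma spanned_mulx w : spanned w -> spanned (x * w).
Proof.
move: w; apply: spanned_ind => [|u v|r u|a b c abc].
- by rewrite mulr0; apply: spanned0.
- by move=> Hu Hv; rewrite mulrDr; apply: spannedD.
- by move=> Hu; rewrite -scalerAr; apply: spannedZ.
rewrite -pmonoXn x_pmono; apply: spannedD; first exact: spanned_pmono.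
by case: a abc => [|a] abc; [exact: spanned0 | exact: spanned_pmono].
Qed.

Lemma spanned_muly w : spanned w -> spanned (y * w).
Proof.
move: w; apply: spanned_ind => [|u v|r u|a b c abc].
- by rewrite mulr0; apply: spanned0.
- by move=> Hu Hv; rewrite mulrDr; apply: spannedD.
- by move=> Hu; rewrite -scalerAr; apply: spannedZ.
by rewrite -pmonoXn y_pmono; apply: spanned_pmono.
Qed.

Lemma spanned_mulh w : spanned w -> spanned (h * w).
Proof.
move: w; apply: spanned_ind => [|u v|r u|a b c abc].
- by rewrite mulr0; apply: spanned0.
- by move=> Hu Hv; rewrite mulrDr; apply: spannedD.
- by move=> Hu; rewrite -scalerAr; apply: spannedZ.
suff -> : h * amono a b c = pmono a (('X + a%:R) * 'X^b) c by apply: spanned_pmono.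
rewrite /amono !mulrA h_yn /pmono rmorphM rmorphD rmorphXn /= horner_algX rmorph_nat.
by rewrite !mulrA.
Qed.

(** Left multiplication by each generator preserves the span, and a monomial u acts on v one
    generator at a time. *)
Lemma spannedM u v : spanned u -> spanned v -> spanned (u * v).
Proof.
move=> Hu Hv; move: u Hu; apply: spanned_ind => [|u w|r u|a b c _].
- by rewrite mul0r; apply: spanned0.
- by move=> Hu Hw; rewrite mulrDl; apply: spannedD.
- by move=> Hu; rewrite -scalerAl; apply: spannedZ.
rewrite /amono -!mulrA.
elim: a => [|a IH]; last by rewrite exprS -mulrA; apply: spanned_muly.
rewrite mul1r; elim: b => [|b IH]; last by rewrite exprS -mulrA; apply: spanned_mulh.
rewrite mul1r; elim: c => [|c IH]; last by rewrite exprS -mulrA; apply: spanned_mulx.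
by rewrite mul1r.
Qed.

Lemma spanned1 : spanned 1.
Proof. by have := @spanned_mono 0 0 0 isT; rewrite /amono !mulr1. Qed.

Lemma spanned_x : spanned x.
Proof. by rewrite -[x]mulr1; apply: spanned_mulx; apply: spanned1. Qed.

Lemma spanned_y : spanned y.
Proof. by rewrite -[y]mulr1; apply: spanned_muly; apply: spanned1. Qed.

Lemma spanned_h : spanned h.
Proof. by rewrite -[h]mulr1; apply: spanned_mulh; apply: spanned1. Qed.

Lemma spannedX u n : spanned u -> spanned (u ^+ n).
Proof.
move=> Hu; elim: n => [|n IH]; first exact: spanned1.
by rewrite exprS; apply: spannedM.
Qed.

End Straightening.

(** * Operators on tensor space *)

(* An alias: MathComp only equips matrices of successor size with an algebra
   structure, and [2 ^ d] is not syntactically a successor. *)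
Definition tensor_end (d : nat) : Type := 'M[rat]_(2 ^ d).

HB.instance Definition _ d := GRing.PzRing.on (tensor_end d).
HB.instance Definition _ d := GRing.Lmodule.on (tensor_end d).

Lemma tensor_end_nonzero1 d : 1 != 0 :> tensor_end d.
Proof.
apply/eqP => /matrixP /(_ (Ordinal (expn_gt0 2 d : 0 < 2 ^ d)%N) (Ordinal (expn_gt0 2 d))).
by rewrite !mxE eqxx => /eqP; rewrite oner_eq0.
Qed.

HB.instance Definition _ d :=
  GRing.PzSemiRing_isNonZero.Build (tensor_end d) (@tensor_end_nonzero1 d).
HB.instance Definition _ d :=
  GRing.LSemiModule_isLSemiAlgebra.Build rat (tensor_end d)
    (@scalemxAl rat (2 ^ d) (2 ^ d) (2 ^ d)).
HB.instance Definition _ d :=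
  GRing.LSemiAlgebra_isSemiAlgebra.Build rat (tensor_end d)
    (fun k => @scalemxAr rat (2 ^ d) (2 ^ d) (2 ^ d) k).

Lemma tensor_endME d (A C : tensor_end d) i j : (A * C) i j = \sum_k A i k * C k j.
Proof. exact: mxE. Qed.

Lemma tensor_endDE d (A C : tensor_end d) i j : (A + C) i j = A i j + C i j.
Proof. exact: mxE. Qed.

Lemma tensor_endZE d a (A : tensor_end d) i j : (a *: A) i j = a * A i j.
Proof. exact: mxE. Qed.

Lemma tensor_end_sumE d I (r : seq I) (P : pred I) (F : I -> tensor_end d) i j :
  (\sum_(k <- r | P k) F k) i j = \sum_(k <- r | P k) F k i j.
Proof. exact: summxE. Qed.

Lemma tensor_end1E d i j : (1 : tensor_end d) i j = (i == j)%:R.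
Proof. exact: mxE. Qed.

Lemma digit_inj d (i j : 'I_(2 ^ d)) : digit i =1 digit j -> i = j.
Proof.
case: i j => [i iP] [j jP] E; apply: val_inj => /=.
have {}E k : (k < d)%N -> ((i %/ 2 ^ k) %% 2 = (j %/ 2 ^ k) %% 2)%N.
  move=> kd; have := congr1 val (E (Ordinal kd)); rewrite /digit /=.
  by rewrite !inordK // ltn_mod.
(* Digit 0 is the parity of the index; the remaining digits are those of its half. *)
elim: d i j iP jP E => [|d IH] i j iP jP E; first by case: i j iP jP {E} => [|i] [].
have E0 := E 0%N isT; rewrite expn0 !divn1 in E0.
rewrite (divn_eq i 2) (divn_eq j 2) E0 (IH (i %/ 2) (j %/ 2))%N //.
- by rewrite ltn_divLR // -expnSr.
- by rewrite ltn_divLR // -expnSr.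
by move=> k kd; have := E k.+1; rewrite ltnS expnS !divnMA => /(_ kd).
Qed.

Definition word d (i : 'I_(2 ^ d)) : {ffun 'I_d -> 'I_2} := [ffun k => digit i k].

Lemma word_bij d : bijective (@word d).
Proof.
apply: inj_card_bij => [i j /ffunP E|]; last by rewrite card_ffun !card_ord.
by apply: digit_inj => k; have := E k; rewrite !ffunE.
Qed.

Definition tens d (X : 'I_d -> 'M[rat]_2) : tensor_end d :=
  \matrix_(i, j) \prod_(k < d) X k (digit i k) (digit j k).

Lemma tensE d (X : 'I_d -> 'M[rat]_2) i j :
  tens X i j = \prod_(k < d) X k (digit i k) (digit j k).
Proof. exact: mxE. Qed.

Lemma eq_tens d (X Y : 'I_d -> 'M[rat]_2) : X =1 Y -> tens X = tens Y.
Proof.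
by move=> E; apply/matrixP => i j; rewrite !tensE; apply: eq_bigr => k _; rewrite E.
Qed.

(** Distributing a product of d sums over the two letters gives a sum over words, and words
    correspond bijectively to the indices below 2^d. *)
Lemma tensM d (X Y : 'I_d -> 'M[rat]_2) : tens X * tens Y = tens (fun k => X k *m Y k).
Proof.
apply/matrixP => i j; rewrite tensor_endME tensE.
under [RHS]eq_bigr => k _ do rewrite mxE.
rewrite bigA_distr_bigA (reindex (@word d)) /=; last exact/onW_bij/word_bij.
apply: eq_bigr => l _; rewrite !tensE -big_split; apply: eq_bigr => k _.
by rewrite ffunE.
Qed.

Lemma tens1 d : tens (fun _ : 'I_d => 1%:M) = 1.
Proof.
apply/matrixP => i j; rewrite tensE tensor_end1E.
have [->|ij] := eqVneq i j; first by rewrite big1 // => k _; rewrite mxE eqxx.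
have /forallPn[k nk] : ~~ [forall k, digit i k == digit j k].
  by apply: contra ij => /forallP E; apply/eqP/digit_inj => k; apply/eqP.
by rewrite (bigD1 k) //= mxE (negPf nk) mul0r.
Qed.

Lemma tensor_repM d g1 g2 : tensor_rep d (g1 *m g2) = tensor_rep d g1 *m tensor_rep d g2.
Proof. by have := tensM (fun _ : 'I_d => g1) (fun _ => g2). Qed.

Definition site d (k : 'I_d) (A : 'M[rat]_2) : tensor_end d :=
  tens (fun l => if l == k then A else 1%:M).

Lemma siteE d (k : 'I_d) A i j :
  site k A i j = A (digit i k) (digit j k)
                 * \prod_(l < d | l != k) (digit i l == digit j l)%:R.
Proof.
rewrite tensE (bigD1 k) //= eqxx; congr (_ * _); apply: eq_bigr => l /negPf->.
by rewrite mxE.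
Qed.

Lemma siteD d (k : 'I_d) A C : site k (A + C) = site k A + site k C.
Proof. by apply/matrixP => i j; rewrite tensor_endDE !siteE mxE mulrDl. Qed.

Lemma siteZ d (k : 'I_d) a A : site k (a *: A) = a *: site k A.
Proof. by apply/matrixP => i j; rewrite tensor_endZE !siteE mxE mulrA. Qed.

Lemma site1 d (k : 'I_d) : site k 1%:M = 1.
Proof. by rewrite -tens1; apply: eq_tens => l; case: ifP. Qed.

Lemma siteM d (k : 'I_d) A C : site k A * site k C = site k (A *m C).
Proof. by rewrite /site tensM; apply: eq_tens => l; case: ifP; rewrite ?mul1mx. Qed.

Lemma site_comm d (k l : 'I_d) A C : k != l -> GRing.comm (site k A) (site l C).
Proof.
move=> kl; rewrite /GRing.comm /site !tensM; apply: eq_tens => m.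
by case: eqP => [->|_]; [rewrite (negPf kl) mul1mx mulmx1 | rewrite mul1mx mulmx1].
Qed.

(** * The differentiated representation of gl_2 on tensor space *)

Definition drho d (A : 'M[rat]_2) : tensor_end d := \sum_(k < d) site k A.

Lemma drhoD d A C : drho d (A + C) = drho d A + drho d C.
Proof. by rewrite /drho -big_split; apply: eq_bigr => k _; rewrite siteD. Qed.

Lemma drhoZ d a A : drho d (a *: A) = a *: drho d A.
Proof. by rewrite /drho scaler_sumr; apply: eq_bigr => k _; rewrite siteZ. Qed.

Lemma drhoB d A C : drho d (A - C) = drho d A - drho d C.
Proof. by rewrite drhoD -scaleN1r drhoZ scaleN1r. Qed.

Lemma drho1 d : drho d 1%:M = d%:R.
Proof.
rewrite /drho (eq_bigr (fun _ => 1)) => [|k _]; last exact: site1.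
by rewrite sumr_const card_ord.
Qed.

(** Operators at distinct sites commute, so only the brackets at a common site remain. *)
Lemma drho_lie d A C : drho d A * drho d C - drho d C * drho d A = drho d (A *m C - C *m A).
Proof.
rewrite /drho !mulr_suml.
under eq_bigr do rewrite mulr_sumr.
under [X in _ - X]eq_bigr do rewrite mulr_sumr.
rewrite [X in _ - X]exchange_big /= -sumrB; apply: eq_bigr => k _.
rewrite -sumrB (bigD1 k) //= big1 ?addr0 => [|l lk].
  by rewrite !siteM siteD -[- (C *m A)]scaleN1r siteZ scaleN1r.
by rewrite site_comm ?subrr // eq_sym.
Qed.

Definition op_e d := drho d (delta_mx 0 1).
Definition op_f d := drho d (delta_mx 1 0).
Definition op_H d := drho d (delta_mx 1 1).

Lemma ord2P (P : 'I_2 -> Prop) : P 0 -> P 1 -> forall i, P i.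
Proof.
by move=> P0 P1 [[|[|//]] H]; [move: P0 | move: P1]; congr P; apply: val_inj.
Qed.

Lemma delta_mx_sum2 : delta_mx 0 0 + delta_mx 1 1 = 1%:M :> 'M[rat]_2.
Proof. by apply/matrixP; do 2![elim/ord2P]; rewrite !mxE. Qed.

(** The tensor positions holding e_2. Basis vectors thus correspond to subsets of the d positions,
    and the cardinality is the eigenvalue of [op_H]. *)
Definition supp d (i : 'I_(2 ^ d)) : {set 'I_d} := [set k | digit i k == 1].

Definition weight d (i : 'I_(2 ^ d)) : nat := #|supp i|.

Lemma in_supp d (i : 'I_(2 ^ d)) k : (k \in supp i) = (digit i k == 1).
Proof. by rewrite inE. Qed.

Lemma card_set_ord d (S : {set 'I_d}) : (#|S| <= d)%N.
Proof. by apply: leq_trans (max_card _) _; rewrite card_ord. Qed.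

Lemma weight_le d (i : 'I_(2 ^ d)) : (weight i <= d)%N.
Proof. exact: card_set_ord. Qed.

Lemma op_HE d i j : op_H d i j = (weight i)%:R * (i == j)%:R.
Proof.
rewrite /op_H /drho tensor_end_sumE /weight -sum1_card natr_sum mulr_suml [RHS]big_mkcond /=.
apply: eq_bigr => k _; rewrite siteE mxE in_supp.
have [->|ij] := eqVneq i j.
  by case: eqP => /= _; rewrite ?mul0r // mul1r big1 // => l _; rewrite eqxx.
rewrite mulr0 if_same; case: (eqVneq (digit i k) 1) => [ik|]; last by rewrite mul0r.
have [jk|] := eqVneq (digit j k) 1; last by rewrite mul0r.
have /forallPn[l nl] : ~~ [forall k, digit i k == digit j k].
  by apply: contra ij => /forallP E; apply/eqP/digit_inj => l; apply/eqP.
rewrite (bigD1 l) ?(negPf nl) /= ?mul0r ?mulr0 //.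
by apply: contraNneq nl => ->; rewrite ik jk.
Qed.

Lemma op_H_hornerE d p i j : horner_alg (op_H d) p i j = p.[(weight i)%:R] * (i == j)%:R.
Proof.
elim/poly_ind: p i j => [|p c IH] i j; first by rewrite rmorph0 horner0 mul0r mxE.
rewrite rmorphD rmorphM /= horner_algX horner_algC mxE tensor_endME mxE tensor_end1E.
rewrite hornerMXaddC mulrDl; congr (_ + _).
rewrite (bigD1 i) //= IH eqxx mulr1 op_HE mulrA big1 ?addr0 // => l li.
by rewrite IH eq_sym (negPf li) mulr0 mul0r.
Qed.

Lemma op_H_XnE d n i j : (op_H d ^+ n) i j = (weight i)%:R ^+ n * (i == j)%:R.
Proof. by have := op_H_hornerE 'X^n i j; rewrite rmorphXn /= horner_algX hornerXn. Qed.

Lemma op_rels d : alg_rels d (op_e d) (op_f d) (op_H d).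
Proof.
split.
- rewrite drho_lie mul_delta_mx_0 // mul_delta_mx sub0r -scaleN1r drhoZ.
  by rewrite scaleN1r.
(* [E_12, E_21] = E_11 - E_22 = 1 - 2 E_22, and the identity matrix acts by d. *)
- rewrite drho_lie !mul_delta_mx -drho1 mulr_natl -scaler_nat -drhoZ -drhoB.
  by rewrite -delta_mx_sum2 scaler_nat mulr2n opprD addrACA subrr addr0.
- by rewrite drho_lie mul_delta_mx mul_delta_mx_0 // subr0.
(* H is diagonal with entries among 0, ..., d, all of them roots of P. *)
pose P : {poly rat} := \prod_(i < d.+1) ('X - i%:R%:P).
have -> : \prod_(i < d.+1) (op_H d - i%:R) = horner_alg (op_H d) P.
  rewrite rmorph_prod; apply: eq_bigr => i _.
  by rewrite rmorphB /= horner_algX polyC_natr rmorph_nat.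
apply/matrixP => i j; rewrite op_H_hornerE mxE horner_prod.
by rewrite (bigD1 (Ordinal (weight_le i : weight i < d.+1)%N)) //= hornerXsubC subrr !mul0r.
Qed.

(** * Generators from group elements *)

Definition linear_subspace (V : lmodType rat) (P : V -> Prop) : Prop :=
  [/\ P 0, forall u v, P u -> P v -> P (u + v) & forall a u, P u -> P (a *: u)].

Lemma subspace_sum (V : lmodType rat) (P : V -> Prop) I (r : seq I) (Q : pred I) F :
  linear_subspace P -> (forall i, Q i -> P (F i)) -> P (\sum_(i <- r | Q i) F i).
Proof. by case=> P0 PD _ PF; apply: big_ind. Qed.

Lemma subspace_unitmx (V : lmodType rat) (P : V -> Prop) n (M : 'M[rat]_n) (R : 'I_n -> V) :
  linear_subspace P -> M \in unitmx -> (forall t, P (\sum_m M m t *: R m)) ->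
  forall m, P (R m).
Proof.
move=> PS uM PM s.
suff -> : R s = \sum_t invmx M t s *: (\sum_m M m t *: R m).
  by apply: subspace_sum => // t _; case: PS => _ _; apply.
under eq_bigr do rewrite scaler_sumr.
rewrite exchange_big (bigD1 s) //= [X in _ + X]big1 ?addr0 => [|m ms].
  under eq_bigr do rewrite scalerA mulrC.
  rewrite -scaler_suml; have /matrixP /(_ s s) := mulmxV uM.
  by rewrite !mxE eqxx => ->; rewrite scale1r.
under eq_bigr do rewrite scalerA mulrC.
rewrite -scaler_suml; have /matrixP /(_ m s) := mulmxV uM.
by rewrite !mxE (negPf ms) => ->; rewrite scale0r.
Qed.

(** A Vandermonde matrix with the distinct nodes k, ..., k+n-1. The offset allows the node 0 to be
    avoided. *)
Lemma unitmx_powers n k : \matrix_(m < n, t < n) ((t + k)%:R ^+ m) \in @unitmx rat n.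
Proof.
have -> : \matrix_(m < n, t < n) ((t + k)%:R ^+ m) =
    Vandermonde n (\row_(t < n) (t + k)%:R) :> 'M[rat]_n.
  by apply/matrixP => m t; rewrite !mxE.
rewrite unitmxE det_Vandermonde unitfE; apply/prodf_neq0 => i _.
apply/prodf_neq0 => j ij; rewrite !mxE subr_eq0 eqr_nat; lia.
Qed.

(** A vector-valued polynomial in t with values in a subspace at all integers t >= k has its
    coefficients there too. *)
Lemma subspace_coefs (V : lmodType rat) (P : V -> Prop) n k (R : 'I_n -> V) :
  linear_subspace P -> (forall t : nat, (k <= t)%N -> P (\sum_(m < n) t%:R ^+ m *: R m)) ->
  forall m, P (R m).
Proof.
move=> PS PR; apply: (subspace_unitmx PS (unitmx_powers n k)) => t.
by under eq_bigr do rewrite mxE; apply: PR; lia.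
Qed.

(** The transposed system: the vectors are recovered from their power moments. *)
Lemma subspace_moments (V : lmodType rat) (P : V -> Prop) n (R : 'I_n -> V) :
  linear_subspace P -> (forall t : nat, P (\sum_(m < n) m%:R ^+ t *: R m)) ->
  forall m, P (R m).
Proof.
move=> PS PR.
have uV : (\matrix_(m < n, t < n) ((t + 0)%:R ^+ m))^T \in @unitmx rat n.
  by rewrite unitmx_tr unitmx_powers.
by apply: (subspace_unitmx PS uV) => t; under eq_bigr do rewrite !mxE addn0; apply: PR.
Qed.

(* Squares of the [eps k] vanish, so [1 + t eps_k] is [exp (t eps_k)]. *)
Lemma prod_exp_nilpotent (B : algType rat) (I : eqType) (s : seq I) (eps : I -> B) (t : rat) :
  uniq s -> (forall k, eps k * eps k = 0) ->
  (forall k l, k != l -> GRing.comm (eps k) (eps l)) ->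
  (\sum_(k <- s) eps k) ^+ (size s).+1 = 0 /\
  \prod_(k <- s) (1 + t *: eps k) =
    \sum_(m < (size s).+1) (t ^+ m / m`!%:R) *: (\sum_(k <- s) eps k) ^+ m.
Proof.
move=> us sq cm; elim: s us => [_|k s IH /= /andP[ks us]].
  by rewrite !big_nil expr1 big_ord1 !expr0 fact0 divr1 scale1r.
have {IH} [S0 PE] := IH us; rewrite !big_cons {}PE.
set n := size s in S0 *; set S := \sum_(k <- s) _ in S0 *.
have cS : GRing.comm (eps k) S.
  rewrite /GRing.comm /S mulr_sumr mulr_suml big_seq [RHS]big_seq.
  apply: eq_bigr => l ls.
  by apply: cm; apply: contraNneq ks => ->.
(* The binomial formula stops after the first power of [eps k], whose square is 0. *)
have pw m : (eps k + S) ^+ m.+1 = S ^+ m.+1 + m.+1%:R *: (eps k * S ^+ m).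
  elim: m => [|m IHm]; first by rewrite !expr1 expr0 mulr1 scale1r addrC.
  rewrite exprS IHm mulrDl !mulrDr -!scalerAr mulrA sq mul0r scaler0 addr0.
  rewrite -exprS [S * (_ * _)]mulrA -cS -mulrA -exprS addrC -addrA; congr (_ + _).
  by rewrite -[X in _ + X]scale1r -scalerDl natr1.
split.
  by rewrite pw exprS S0 mulr0 add0r mulr0 scaler0.
rewrite mulrDl mul1r -scalerAl mulr_sumr scaler_sumr.
rewrite [RHS]big_ord_recl /= expr0 fact0 divr1 scale1r.
rewrite [X in X + _ = _]big_ord_recl /= expr0 fact0 divr1 scale1r -addrA; congr (_ + _).
under [in RHS]eq_bigr do rewrite /bump /= add1n pw scalerDr.
rewrite [RHS]big_split /=; congr (_ + _).
  by rewrite [RHS]big_ord_recr /= S0 scaler0 addr0.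
apply: eq_bigr => m _; rewrite -scalerAr !scalerA; congr (_ *: _).
rewrite exprS factS natrM; have m0 : m`!%:R != 0 :> rat by rewrite pnatr_eq0 -lt0n fact_gt0.
have m1 : m.+1%:R != 0 :> rat by rewrite pnatr_eq0.
by field; rewrite m0 addrC natr1 m1.
Qed.

Lemma prod_site d (s : seq 'I_d) (X : 'M[rat]_2) : uniq s ->
  \prod_(k <- s) site k X = tens (fun l => if l \in s then X else 1%:M).
Proof.
elim: s => [_|k s IH /= /andP[ks us]]; first by rewrite big_nil -tens1.
rewrite big_cons IH // tensM; apply: eq_tens => l; rewrite inE.
by case: eqP => [->|_] /=; [rewrite (negPf ks) mulmx1 | rewrite mul1mx].
Qed.

(** The d-th tensor power of 1 + tN is the product over the sites of the commuting factors 1 + t N_k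
    with N_k^2 = 0, so it is the exponential of t times the sum of the N_k, truncated at degree
    d. *)
Lemma tensor_rep_exp d (N : 'M[rat]_2) (t : rat) : N *m N = 0 ->
  tensor_rep d (1%:M + t *: N) =
    \sum_(m < d.+1) (t ^+ m / m`!%:R) *: drho d N ^+ m :> tensor_end d.
Proof.
move=> NN; have us := index_enum_uniq 'I_d.
have [|k l kl|_] := prod_exp_nilpotent t us (eps := fun k => site k N).
- move=> k; rewrite siteM NN; apply/matrixP => i j.
  by rewrite siteE !mxE mul0r.
- exact: site_comm.
have sz : size (index_enum 'I_d) = d by rewrite /index_enum -enumT size_enum_ord.
rewrite sz => <-.
under eq_bigr => k do rewrite -siteZ -(site1 k) -siteD.
by rewrite prod_site //; apply: eq_tens => l; rewrite mem_index_enum.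
Qed.

(** * Closure properties of S(2,d) and membership of e, f, H *)

Section SchurClosure.
Variable d : nat.

Lemma schur_rep g : g \in unitmx -> in_schur (tensor_rep d g).
Proof.
move=> ug; exists 1%N, (fun _ => 1), (fun _ => g); split=> //.
by rewrite big_ord1 scale1r.
Qed.

Lemma schur_subspace : @linear_subspace (tensor_end d) (@in_schur d).
Proof.
split=> [|u v [n [c [g [ug ->]]]] [m [c' [g' [ug' ->]]]]|a u [n [c [g [ug ->]]]]].
- by exists 0%N, (fun _ => 0), (fun _ => 1%:M); split=> [[]//|]; rewrite big_ord0.
- exists (n + m)%N, (fun t => match split t with inl i => c i | inr i => c' i end).
  exists (fun t => match split t with inl i => g i | inr i => g' i end).
  split=> [t|]; first by case: (split t).
  rewrite big_split_ord /=; congr (_ + _); apply: eq_bigr => i _.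
    by rewrite (unsplitK (inl i)).
  by rewrite (unsplitK (inr i)).
exists n, (fun t => a * c t), g; split=> //.
by rewrite scaler_sumr; apply: eq_bigr => i _; rewrite scalerA.
Qed.

Lemma schur_ind (P : tensor_end d -> Prop) : linear_subspace P ->
  (forall g, g \in unitmx -> P (tensor_rep d g)) -> forall A, in_schur A -> P A.
Proof.
move=> PS Pg A [n [c [g [ug ->]]]]; apply: (@subspace_sum (tensor_end d) P
  _ (index_enum _) _ (fun t => c t *: tensor_rep d (g t) : tensor_end d) PS) => i _.
by case: PS => _ _; apply; apply: Pg.
Qed.

Lemma schurM (A C : tensor_end d) : in_schur A -> in_schur C -> in_schur (A * C).
Proof.
have [S0 SD SZ] := schur_subspace => HA HC; move: A HA; apply: schur_ind.
  split=> [|u v Hu Hv|a u Hu]; first by rewrite mul0r.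
    by rewrite mulrDl; apply: SD.
  by rewrite -scalerAl; apply: SZ.
move=> g ug; move: C HC; apply: schur_ind.
  split=> [|u v Hu Hv|a u Hu]; first by rewrite mulr0.
    by rewrite mulrDr; apply: SD.
  by rewrite -scalerAr; apply: SZ.
move=> g' ug'; rewrite /GRing.mul /= -tensor_repM; apply: schur_rep.
by rewrite unitmx_mul ug.
Qed.

Lemma schur1 : in_schur (1 : tensor_end d).
Proof. by rewrite -tens1; apply: schur_rep; rewrite unitmx1. Qed.

Lemma unitmx_unipotent (N : 'M[rat]_2) t : N *m N = 0 -> 1%:M + t *: N \in unitmx.
Proof.
move=> NN; suff /mulmx1_unit[] : (1%:M + t *: N) *m (1%:M - t *: N) = 1%:M by [].
rewrite mulmxDl mul1mx mulmxBr mulmx1 -scalemxAl -scalemxAr NN !scaler0 subr0.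
by rewrite subrK.
Qed.

(** The operator is the coefficient of t in the action of 1 + tN, extracted from integer values of
    t. For d > 0 the truncated series does contain the index 1. *)
Lemma schur_drho_nilpotent (N : 'M[rat]_2) : (0 < d)%N -> N *m N = 0 -> in_schur (drho d N).
Proof.
move=> d0 NN.
have := @subspace_coefs (tensor_end d) _ d.+1 0
  (fun m : 'I_d.+1 => m`!%:R^-1 *: drho d N ^+ m) schur_subspace.
move=> /(_ _ (Ordinal (d0 : 1 < d.+1)%N)) /=; rewrite invr1 scale1r expr1; apply => t _.
under eq_bigr do rewrite scalerA; rewrite -tensor_rep_exp //.
exact/schur_rep/unitmx_unipotent.
Qed.

Definition diag2 (a b : rat) : 'M[rat]_2 := a *: delta_mx 0 0 + b *: delta_mx 1 1.

Lemma diag2E a b i j : diag2 a b i j = (if i == 1 then b else a) * (i == j)%:R.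
Proof. by elim/ord2P: i; elim/ord2P: j; rewrite !mxE /=; ring. Qed.

(** The projection onto the eigenspace of H for the eigenvalue m. *)
Definition weight_proj (m : nat) : tensor_end d :=
  \matrix_(i, j) ((weight i == m) && (i == j))%:R.

Lemma weight_projE m i j : weight_proj m i j = ((weight i == m) && (i == j))%:R.
Proof. exact: mxE. Qed.

Lemma sum_weight_projE (F : nat -> rat) i j :
  (\sum_(m < d.+1) F m *: weight_proj m) i j = F (weight i) * (i == j)%:R.
Proof.
rewrite tensor_end_sumE (bigD1 (Ordinal (weight_le i : weight i < d.+1)%N)) //=.
rewrite tensor_endZE weight_projE eqxx big1 ?addr0 // => m nm.
rewrite tensor_endZE weight_projE; case: eqP => [E|]; last by rewrite mulr0.
by case/eqP: nm; apply: val_inj.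
Qed.

Lemma tensor_rep_diag2 a b :
  tensor_rep d (diag2 a b) = \sum_(m < d.+1) (a ^+ (d - m) * b ^+ m) *: weight_proj m.
Proof.
apply/matrixP => i j; rewrite (sum_weight_projE (fun m => a ^+ (d - m) * b ^+ m)) mxE.
under eq_bigr do rewrite diag2E; rewrite big_split /=; congr (_ * _); last first.
  by have := tensE (fun _ : 'I_d => 1%:M) i j; rewrite tens1 tensor_end1E => ->;
     apply: eq_bigr => k _; rewrite mxE.
rewrite (bigID (fun k => digit i k == 1)) /= mulrC; congr (_ * _).
  rewrite (eq_bigr (fun _ => a)) => [|k /negPf->] //; rewrite prodr_const; congr (_ ^+ _).
  have <- : #|~: supp i| = (d - weight i)%N by rewrite cardsCs setCK card_ord.
  by apply: eq_card => k; rewrite !inE.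
rewrite (eq_bigr (fun _ => b)) => [|k ->] //; rewrite prodr_const; congr (_ ^+ _).
by apply: eq_card => k; rewrite !inE.
Qed.

Lemma op_H_proj n : op_H d ^+ n = \sum_(m < d.+1) m%:R ^+ n *: weight_proj m.
Proof.
by apply/matrixP => i j; rewrite op_H_XnE (sum_weight_projE (fun m => m%:R ^+ n)).
Qed.

Lemma schur_op_H : in_schur (op_H d).
Proof.
have [S0 SD SZ] := schur_subspace.
rewrite -[op_H d]expr1 op_H_proj.
apply: (@subspace_sum (tensor_end d) (@in_schur d) _ (index_enum _) _
  (fun m : 'I_d.+1 => m%:R ^+ 1 *: weight_proj m : tensor_end d) schur_subspace) => m _.
(* The projections are the coefficients in t of the action of diag(1,t). Only t >= 1 is used, which
   makes this matrix invertible. *)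
apply: SZ; apply: (subspace_coefs (k := 1) (V := tensor_end d) (n := d.+1)
  (R := fun m : 'I_d.+1 => weight_proj m) schur_subspace) => t t0.
have := tensor_rep_diag2 1 t%:R.
under eq_bigr do rewrite expr1n mul1r; move=> <-; apply: schur_rep.
suff /mulmx1_unit[] : diag2 1 t%:R *m diag2 1 t%:R^-1 = 1%:M by [].
have t1 : t%:R != 0 :> rat by rewrite pnatr_eq0 -lt0n.
apply/matrixP => i j; rewrite mxE !big_ord_recl big_ord0 !diag2E mxE.
by elim/ord2P: i; elim/ord2P: j; rewrite /= ?mulr0 ?mul0r ?mulr1 ?mul1r ?addr0 ?add0r ?divff.
Qed.

Lemma drho_d0 A : d = 0%N -> drho d A = 0.
Proof. by move=> d0; rewrite /drho big1 // => k; have := ltn_ord k; rewrite {2}d0. Qed.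

Lemma schur_op_e : in_schur (op_e d).
Proof.
have [d0|] := posnP d; first by rewrite /op_e drho_d0 //; case: schur_subspace.
by move=> d0; apply: schur_drho_nilpotent => //; rewrite mul_delta_mx_0.
Qed.

Lemma schur_op_f : in_schur (op_f d).
Proof.
have [d0|] := posnP d; first by rewrite /op_f drho_d0 //; case: schur_subspace.
by move=> d0; apply: schur_drho_nilpotent => //; rewrite mul_delta_mx_0.
Qed.

End SchurClosure.

(** * Independence and spanning of the monomials *)

Lemma supp_surj d (S : {set 'I_d}) : exists i : 'I_(2 ^ d), supp i = S.
Proof.
have [g _ gK] := word_bij d.
exists (g [ffun k => if k \in S then 1 else 0]); apply/setP => k; rewrite in_supp.
have /ffunP /(_ k) := gK [ffun k => if k \in S then 1 else 0].
by rewrite !ffunE => ->; case: (k \in S).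
Qed.

Lemma digit_eq1 d (i : 'I_(2 ^ d)) k : digit i k = if k \in supp i then 1 else 0.
Proof. by rewrite in_supp; elim/ord2P: (digit i k). Qed.

(** Position by position: passing from e_2 to e_1 costs a factor t, keeping the letter costs 1, and
    passing from e_1 to e_2 is impossible. *)
Lemma tensor_rep_upperE d t i j :
  tensor_rep d (1%:M + t *: delta_mx 0 1) i j =
  (supp i \subset supp j)%:R * t ^+ #|supp j :\: supp i|.
Proof.
have fE k : (1%:M + t *: delta_mx 0 1 : 'M[rat]_2) (digit i k) (digit j k) =
   if k \in supp j :\: supp i then t else ((k \in supp i) ==> (k \in supp j))%:R.
  rewrite !digit_eq1 !mxE in_setD.
  by case: (k \in supp i); case: (k \in supp j) => /=; ring.
rewrite mxE; under eq_bigr do rewrite fE.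
have [/subsetP sij|/subsetPn[k ki kj]] := boolP (supp i \subset supp j).
  rewrite mul1r -prodr_const [RHS]big_mkcond; apply: eq_bigr => k _.
  by case: ifP => // _; case: (boolP (k \in supp i)) => // /sij ->.
by rewrite mul0r (bigD1 k) //= in_setD ki (negPf kj) mul0r.
Qed.

Lemma op_e_XnE d n i j : (n <= d)%N ->
  (op_e d ^+ n) i j =
  n`!%:R * ((supp i \subset supp j) && (#|supp j :\: supp i| == n))%:R.
Proof.
rewrite -ltnS => nd.
pose b (m : nat) : rat := ((supp i \subset supp j) && (#|supp j :\: supp i| == m))%:R.
(* The (i,j) entry of the action of 1 + t E_12 is a polynomial in t in two ways: by the exponential
   series and by counting positions. [R] collects the differences of coefficients, and coefficient
   extraction is applied to the zero subspace. *)
pose R (m : 'I_d.+1) : rat^o := m`!%:R^-1 * (op_e d ^+ m) i j - b m.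
have f0 m : m`!%:R != 0 :> rat by rewrite pnatr_eq0 -lt0n fact_gt0.
suff /(_ (Ordinal nd)) /eqP : forall m, R m = 0.
  by rewrite /R subr_eq0 /= -/(b n) => /eqP <-; rewrite mulVKf.
apply: (@subspace_coefs rat^o (fun u => u = 0) d.+1 0 R).
  by split=> [|u v -> ->|a u ->]; rewrite ?addr0 ?scaler0.
move=> t _; have ee : (delta_mx 0 1 : 'M[rat]_2) *m (delta_mx 0 1 : 'M[rat]_2) = 0.
  by rewrite mul_delta_mx_0.
have := tensor_rep_upperE t%:R i j; rewrite (tensor_rep_exp d t%:R ee).
rewrite tensor_end_sumE => E.
have -> : \sum_(m < d.+1) t%:R ^+ m *: R m =
    \sum_(m < d.+1) ((t%:R ^+ m / m`!%:R) *: op_e d ^+ m) i j - \sum_(m < d.+1) t%:R ^+ m * b m.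
  by rewrite -sumrB; apply: eq_bigr => m _; rewrite tensor_endZE -mulrA -mulrBr.
have nb : (#|supp j :\: supp i| < d.+1)%N by rewrite ltnS card_set_ord.
rewrite E (bigD1 (Ordinal nb)) //= big1 ?addr0 => [|m nm].
  by rewrite /b eqxx andbT mulrC subrr.
rewrite /b [_ == _]eq_sym; case: eqP => [E'|]; last by rewrite andbF mulr0.
by case/eqP: nm; apply: val_inj.
Qed.

Lemma op_f_tr d i j : op_f d i j = op_e d j i.
Proof.
rewrite /op_f /op_e /drho !tensor_end_sumE; apply: eq_bigr => k _.
rewrite !siteE !mxE andbC; congr (_ * _).
by apply: eq_bigr => l _; rewrite eq_sym.
Qed.

Lemma op_f_XnE d n i j : (op_f d ^+ n) i j = (op_e d ^+ n) j i.
Proof.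
elim: n i j => [|n IH] i j; first by rewrite !expr0 !tensor_end1E eq_sym.
rewrite exprS exprSr !tensor_endME; apply: eq_bigr => l _.
by rewrite IH op_f_tr mulrC.
Qed.

Section Independence.
Variables (d : nat) (k : 'I_d.+1 -> 'I_d.+1 -> 'I_d.+1 -> rat).
Hypothesis k0 : acomb (op_e d) (op_f d) (op_H d) k = 0.

Lemma amono_opE (a b c : nat) i j :
  amono (op_e d) (op_f d) (op_H d) a b c i j =
  \sum_l (op_f d ^+ a) i l * (weight l)%:R ^+ b * (op_e d ^+ c) l j.
Proof.
rewrite /amono tensor_endME; apply: eq_bigr => l _; congr (_ * _).
rewrite tensor_endME (bigD1 l) //= op_H_XnE eqxx mulr1 big1 ?addr0 // => m ml.
by rewrite op_H_XnE (negPf ml) !mulr0.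
Qed.

(** A contributing intermediate index l has its support inside both R :|: A and R :|: C, hence
    inside R, and of size |R| + |C| - c >= |R|. So the support is R and c = |C|, and then a =
    |A|. *)
Lemma amono_op_diagE (R A C : {set 'I_d}) (a b c : nat) i j :
  [disjoint R & A] -> [disjoint R & C] -> [disjoint A & C] ->
  supp i = R :|: A -> supp j = R :|: C ->
  (a <= d)%N -> (c <= #|C|)%N ->
  amono (op_e d) (op_f d) (op_H d) a b c i j =
  ((a == #|A|) && (c == #|C|))%:R * (#|A|`!%:R * #|C|`!%:R * #|R|%:R ^+ b).
Proof.
move=> RA RC AC si sj ad cC; rewrite amono_opE.
have cd : (c <= d)%N by apply: leq_trans cC _; apply: card_set_ord.
have [l0 sl0] := supp_surj R.
rewrite (bigD1 l0) //= big1 ?addr0 => [|l ll0].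
  rewrite op_f_XnE !op_e_XnE // /weight sl0 si sj !subsetUl !setDUl !setDv !set0U.
  have -> : A :\: R = A by apply/setDidPl; rewrite disjoint_sym.
  have -> : C :\: R = C by apply/setDidPl; rewrite disjoint_sym.
  rewrite ![#|_| == _]eq_sym /=.
  by case: eqP => [->|_]; case: eqP => [->|_] /=; ring.
rewrite op_f_XnE !op_e_XnE // si sj.
case: (boolP (supp l \subset R :|: A)) => [sA|]; last by rewrite !(mulr0, mul0r).
case: (boolP (supp l \subset R :|: C)) => [sC|]; last by rewrite !(mulr0, mul0r).
case: (eqVneq #|(R :|: C) :\: supp l| c) => [E|]; last by rewrite andbF !(mulr0, mul0r).
have sR : supp l \subset R.
  apply/subsetP => x xl; move/subsetP/(_ x xl): sA; move/subsetP/(_ x xl): sC.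
  rewrite !inE => /orP[//|xC] /orP[//|xA].
  by have /pred0P /(_ x) := AC; rewrite /= xA xC.
case/eqP: ll0; apply: digit_inj => x; rewrite !digit_eq1 sl0.
suff -> : supp l = R by [].
apply/eqP; rewrite eqEcard sR /=.
have := cardsID (supp l) (R :|: C); rewrite E (setIidPr sC) cardsU.
rewrite (disjoint_setI0 RC) cards0 subn0 => E2.
by rewrite -(leq_add2r c) E2 leq_add2l.
Qed.

Lemma acomb_op_eq0 (a b c : 'I_d.+1) : (a + b + c <= d)%N -> k a b c = 0.
Proof.
(* Descending induction on c: all coefficients with a larger exponent of e already vanish. *)
have [n] := ubnP (d - c); elim: n a b c => // n IH a0 b0 c0; rewrite ltnS => dn abc0.
set D := (d - a0 - c0)%N.
have Db b : (b < D.+1)%N -> (b < d.+1)%N by rewrite /D; lia.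
(* With a0 and c0 fixed, D is the largest admissible b. The D+1 unknowns [K b] will satisfy one
   Vandermonde equation for each r <= D. *)
pose K (b : 'I_D.+1) : rat^o := k a0 (Ordinal (Db b (ltn_ord b))) c0.
suff KE : forall b, K b = 0.
  have b0D : (b0 < D.+1)%N by rewrite /D; lia.
  have := KE (Ordinal b0D); rewrite /K /=.
  by congr (k _ _ _ = _); apply: val_inj.
apply: (@subspace_unitmx rat^o (fun u => u = 0) D.+1 _ K _ (unitmx_powers D.+1 0)).
  by split=> [|u v -> ->|a u ->]; rewrite ?addr0 ?scaler0.
move=> r; have le_d (a : 'I_d.+1) : (a <= d)%N by rewrite -ltnS.
pose seg m p : {set 'I_d} := [set x : 'I_d | (m <= x < m + p)%N].
have seg_card m p : (m + p <= d)%N -> #|seg m p| = p.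
  move=> mpd; have wd (x : 'I_p) : (m + x < d)%N by have := ltn_ord x; lia.
  have inj : injective (fun x : 'I_p => Ordinal (wd x)).
    by move=> x x' /(congr1 val) /= /addnI; apply: val_inj.
  rewrite -[RHS]card_ord -(card_imset _ inj) ?cardsT; apply: eq_card => x.
  rewrite inE; apply/idP/imsetP => [/andP[mx xm]|[x' _ ->] /=].
    have xp : (x - m < p)%N by lia.
    by exists (Ordinal xp) => //; apply: val_inj => /=; lia.
  by have := ltn_ord x'; lia.
have seg_disj m p m' p' : (m + p <= m')%N -> [disjoint seg m p & seg m' p'].
  by move=> mp; apply/pred0P => x /=; rewrite !inE; lia.
have rD := ltn_ord r; have DE : D = (d - a0 - c0)%N by [].
(* Consecutive, hence disjoint, blocks of sizes r, a0 and c0; they fit because r <= D. *)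
pose R := seg 0%N r; pose A := seg r a0; pose C := seg (r + a0)%N c0.
have cR : #|R| = r by apply: seg_card; lia.
have cA : #|A| = a0 by apply: seg_card; lia.
have cC : #|C| = c0 by apply: seg_card; lia.
have [i si] := supp_surj (R :|: A); have [j sj] := supp_surj (R :|: C).
have ent a b c : (c <= c0)%N -> (a <= d)%N ->
    amono (op_e d) (op_f d) (op_H d) a b c i j =
    ((a == a0) && (c == c0))%:R * (a0`!%:R * c0`!%:R * r%:R ^+ b).
  move=> cc ad; rewrite (amono_op_diagE (R := R) (A := A) (C := C)) ?cA ?cC ?cR //;
    by apply: seg_disj; lia.
(* In this entry, terms with c > c0 vanish by induction, and among those with c <= c0 only a = a0, c
   = c0 survives. *)
have := congr1 (fun X : tensor_end d => X i j) k0.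
rewrite /acomb tensor_end_sumE mxE (bigD1 a0) //= [X in _ + X]big1 ?addr0; last first.
  move=> a aa0; rewrite tensor_end_sumE big1 // => b _.
  rewrite tensor_end_sumE big1 // => c abc; rewrite tensor_endZE.
  have [cc|cc] := leqP c c0; last by rewrite IH ?mul0r //; lia.
  by rewrite ent ?le_d // val_eqE (negPf aa0) mul0r mulr0.
rewrite tensor_end_sumE => E.
have {E} : \sum_(b < d.+1 | (a0 + b + c0 <= d)%N)
    k a0 b c0 * (a0`!%:R * c0`!%:R * r%:R ^+ b) = 0.
  rewrite -[RHS]E big_mkcond /=; apply: eq_bigr => b _; rewrite tensor_end_sumE.
  case: ifP => abc; last first.
    rewrite big1 // => c abc'; rewrite tensor_endZE.
    have [cc|cc] := leqP c c0; last by rewrite IH ?mul0r //; lia.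
    rewrite ent ?le_d // eqxx; case: eqP => [cc0|]; last by rewrite mul0r mulr0.
    by rewrite -cc0 abc' in abc.
  rewrite (bigD1 c0) //= tensor_endZE ent ?le_d // !eqxx mul1r big1 ?addr0 //.
  move=> c /andP[abc' nc]; rewrite tensor_endZE.
  have [cc|cc] := leqP c c0; last by rewrite IH ?mul0r //; lia.
  by rewrite ent ?le_d // eqxx val_eqE (negPf nc) mul0r mulr0.
set u := a0`!%:R * c0`!%:R.
have u0 : u != 0 by rewrite mulf_neq0 // pnatr_eq0 -lt0n fact_gt0.
have -> : \sum_(b < d.+1 | (a0 + b + c0 <= d)%N) k a0 b c0 * (u * r%:R ^+ b) =
   u * \sum_(b < D.+1) r%:R ^+ b * K b.
  rewrite mulr_sumr (reindex_omap (fun b : 'I_D.+1 => Ordinal (Db b (ltn_ord b)))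
     (fun b : 'I_d.+1 => insub (b : nat))) /=; last first.
    move=> b abc; have bD : (b < D.+1)%N by rewrite /D; lia.
    by rewrite insubT /=; congr Some; apply: val_inj.
  apply: eq_big => [b|b _]; last by rewrite /K mulrCA; congr (_ * _); rewrite mulrC.
  by rewrite valK eqxx andbT; have := ltn_ord b; lia.
move/eqP; rewrite mulf_eq0 (negPf u0) /= => /eqP E.
by rewrite -[RHS]E; apply: eq_bigr => b _; rewrite mxE addn0.
Qed.

End Independence.

(** * The monomials span S(2,d) *)

Lemma spanned_subspace d (B : algType rat) (x y h : B) : linear_subspace (spanned d x y h).
Proof. by split; [apply: spanned0 | apply: spannedD | apply: spannedZ]. Qed.

Lemma spanned_upper d t :
  spanned d (op_e d) (op_f d) (op_H d) (tensor_rep d (1%:M + t *: delta_mx 0 1)).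
Proof.
rewrite tensor_rep_exp; last by rewrite mul_delta_mx_0.
apply: spanned_sum => m _.
apply/spannedZ/spannedX; [exact: op_rels | exact: (spanned_x (op_rels d))].
Qed.

Lemma spanned_lower d t :
  spanned d (op_e d) (op_f d) (op_H d) (tensor_rep d (1%:M + t *: delta_mx 1 0)).
Proof.
rewrite tensor_rep_exp; last by rewrite mul_delta_mx_0.
apply: spanned_sum => m _.
apply/spannedZ/spannedX; [exact: op_rels | exact: (spanned_y (op_rels d))].
Qed.

(** The powers of H are the moments of the weight projections, so the projections are combinations
    of powers of H. *)
Lemma spanned_diag2 d a b :
  spanned d (op_e d) (op_f d) (op_H d) (tensor_rep d (diag2 a b)).
Proof.
rewrite tensor_rep_diag2; have SS := spanned_subspace d (op_e d) (op_f d) (op_H d).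
apply: spanned_sum => m _; apply: spannedZ.
apply: (subspace_moments (n := d.+1) (R := fun m : 'I_d.+1 => weight_proj d m) SS) => t.
rewrite -op_H_proj; apply: spannedX; first exact: op_rels.
exact: spanned_h (op_rels d).
Qed.

Lemma spanned_rep d g : g \in unitmx ->
  spanned d (op_e d) (op_f d) (op_H d) (tensor_rep d g).
Proof.
have mulS (g1 g2 : 'M[rat]_2) : spanned d (op_e d) (op_f d) (op_H d) (tensor_rep d g1) ->
    spanned d (op_e d) (op_f d) (op_H d) (tensor_rep d g2) ->
    spanned d (op_e d) (op_f d) (op_H d) (tensor_rep d (g1 *m g2)).
  by move=> H1 H2; rewrite tensor_repM; apply: (spannedM (op_rels d) H1 H2).
(* Gaussian elimination with a nonzero pivot: lower unipotent, diagonal, upper unipotent. *)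
have LDU (g' : 'M[rat]_2) : g' 0 0 != 0 ->
    spanned d (op_e d) (op_f d) (op_H d) (tensor_rep d g').
  move=> n0.
  have -> : g' = (1%:M + (g' 1 0 / g' 0 0) *: delta_mx 1 0)
      *m (diag2 (g' 0 0) (g' 1 1 - g' 1 0 * g' 0 1 / g' 0 0)
      *m (1%:M + (g' 0 1 / g' 0 0) *: delta_mx 0 1)).
    apply/matrixP => i j; rewrite !mxE !big_ord_recl !big_ord0 !mxE.
    rewrite !big_ord_recl !big_ord0 !diag2E !mxE.
    by elim/ord2P: i; elim/ord2P: j => /=; field.
  apply/mulS; [exact: spanned_lower | apply: mulS; [exact: spanned_diag2 | exact: spanned_upper]].
move=> ug; have [z00|] := eqVneq (g 0 0) 0; last exact: LDU.
(* With a zero pivot, adding the second row to the first makes the pivot [g 1 0], which is nonzero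
   since otherwise the first column would vanish. *)
have -> : g = (1%:M + (-1) *: delta_mx 0 1) *m ((1%:M + 1 *: delta_mx 0 1) *m g).
  rewrite mulmxA -[LHS]mul1mx; congr (_ *m _).
  by apply/matrixP => i j; rewrite !mxE !big_ord_recl !big_ord0 !mxE;
     elim/ord2P: i; elim/ord2P: j.
apply: mulS; [exact: spanned_upper | apply: LDU].
rewrite !mxE !big_ord_recl !big_ord0 !mxE /= z00.
have -> : lift 0 0 = 1 :> 'I_2 by apply: val_inj.
rewrite mulr0 add0r addr0 mulr1 add0r mul1r.
apply: contraTneq ug => z10; apply/negP => /mulVmx /matrixP /(_ 0 0).
rewrite !mxE !big_ord_recl big_ord0 z00.
have -> : lift 0 0 = 1 :> 'I_2 by apply: val_inj.
by rewrite z10 !mulr0 !addr0 => /eqP; rewrite eq_sym oner_eq0.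
Qed.

Lemma schurP d A : in_schur A <-> spanned d (op_e d) (op_f d) (op_H d) A.
Proof.
split.
  by apply: schur_ind; [apply: spanned_subspace | apply: spanned_rep].
have [S0 SD SZ] := schur_subspace d.
have SX (u : tensor_end d) n : in_schur u -> in_schur (u ^+ n).
  move=> Hu; elim: n => [|n IH]; first exact: schur1.
  by rewrite exprS; apply: schurM.
apply: spanned_ind => // a b c _; rewrite /amono.
apply: schurM; first apply: schurM; apply: SX.
- exact: schur_op_f.
- exact: schur_op_H.
- exact: schur_op_e.
Qed.

(** * The induced morphism *)

Lemma mxpowE d (A : tensor_end d) n : mxpow A n = A ^+ n.
Proof. by elim: n => [//|n IH]; rewrite exprS -IH. Qed.

Lemma mono_combE d (x y h : tensor_end d) k : mono_comb x y h k = acomb x y h k.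
Proof.
apply: eq_bigr => a _; apply: eq_bigr => b _; apply: eq_bigr => c _.
by rewrite /amono -!mxpowE.
Qed.

Lemma mx_relsP d (x y h : tensor_end d) : alg_rels d x y h -> mx_rels x y h.
Proof.
case=> hx xy hy ph.
have nE n : (n%:R)%:M = n%:R :> tensor_end d by rewrite -[LHS]scalemx1 scaler_nat.
split=> //.
  by rewrite nE scaler_nat; move: xy; rewrite mulr_natl.
rewrite -[RHS]ph -(big_mkord xpredT (fun i => h - i%:R)) /index_iota subn0.
elim: (iota 0 d.+1) => [|i s IH]; first by rewrite big_nil.
by rewrite big_cons /= IH nE.
Qed.

Lemma acomb_pair d (B C : algType rat) (x y h : B) (e f H : C) k :
  acomb (d := d) ((x, e) : B * C) (y, f) (h, H) k = (acomb x y h k, acomb e f H k).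
Proof.
have pairX (u : B) (v : C) n : ((u, v) : B * C) ^+ n = (u ^+ n, v ^+ n).
  by elim: n => [//|n IH]; rewrite !exprS IH.
have pairS I (r : seq I) (P : pred I) (F : I -> B) (G : I -> C) :
    \sum_(i <- r | P i) ((F i, G i) : B * C)
    = (\sum_(i <- r | P i) F i, \sum_(i <- r | P i) G i).
  elim: r => [|i r IH]; first by rewrite !big_nil.
  by rewrite !big_cons IH; case: (P i).
rewrite /acomb -pairS; apply: eq_bigr => a _; rewrite -pairS; apply: eq_bigr => b _.
by rewrite -pairS; apply: eq_bigr => c _; rewrite /amono !pairX.
Qed.

Lemma alg_rels_pair d (B C : algType rat) (x y h : B) (e f H : C) :
  alg_rels d x y h -> alg_rels d e f H ->
  alg_rels d ((x, e) : B * C) (y, f) (h, H).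
Proof.
case=> r1 r2 r3 r4 [s1 s2 s3 s4].
have nE n : n%:R = (n%:R, n%:R) :> B * C.
  by elim: n => [//|n IH]; rewrite -!natr1 IH.
split.
- by congr pair.
- by rewrite !nE; congr pair.
- by congr pair.
have pE (s : seq nat) : \prod_(i <- s) (((h, H) : B * C) - i%:R) =
    (\prod_(i <- s) (h - i%:R), \prod_(i <- s) (H - i%:R)).
  by elim: s => [|i s IH]; rewrite ?big_nil // !big_cons IH nE.
have bE (A : pzRingType) (u : A) :
    \prod_(i < d.+1) (u - i%:R) = \prod_(i <- index_iota 0 d.+1) (u - i%:R).
  by rewrite big_mkord.
by rewrite bE pE -!bE r4 s4.
Qed.

Section InducedMorphism.
Variables (d : nat) (B : algType rat) (x y h : B).
Hypothesis rels : alg_rels d x y h.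

Definition graph (A : tensor_end d) (w : B) : Prop :=
  spanned d ((x, op_e d) : B * tensor_end d) (y, op_f d) (h, op_H d) (w, A).

Let prels := alg_rels_pair rels (op_rels d).

(** By independence of the monomials in End, A determines the admissible coefficients, and these
    determine w. *)
Lemma graph_fun A w w' : graph A w -> graph A w' -> w = w'.
Proof.
move=> [k E] [k' E']; move: E E'; rewrite !acomb_pair => -[-> Ek] [-> Ek'].
have : acomb (op_e d) (op_f d) (op_H d) (fun a b c => k a b c + -1 * k' a b c) = 0.
  by rewrite acombD acombZ scaleN1r -Ek -Ek' subrr.
move/acomb_op_eq0 => kk'.
apply: eq_bigr => a _; apply: eq_bigr => b _; apply: eq_bigr => c abc; congr (_ *: _).
by have /eqP := kk' _ _ _ abc; rewrite mulN1r subr_eq0 => /eqP.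
Qed.

Lemma graph_total A : in_schur A -> exists w, graph A w.
Proof.
move=> /schurP [k ->]; exists (acomb x y h k); exists k.
by rewrite acomb_pair.
Qed.

(** [schur_hom] needs a function on all matrices but constrains it only on S(2,d); outside the
    domain of the graph the chosen value is unspecified. *)
Definition induced (A : 'M[rat]_(2 ^ d)) : B := epsilon (inhabits 0) (graph A).

Lemma inducedP A w : graph A w -> induced A = w.
Proof.
move=> gw; apply: (graph_fun _ gw).
by apply: (epsilon_spec (inhabits 0) (graph A)); exists w.
Qed.

Lemma induced_graph A : in_schur A -> graph A (induced A).
Proof. by move=> /graph_total; apply: epsilon_spec. Qed.

(** The pairs of generators satisfy the relations, so the graph is a subalgebra of the product; each
    law is a closure property of it. *)
Lemma induced_hom : schur_hom induced.
Proof.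
split.
- by apply: inducedP; apply: (spanned1 d).
- move=> A C /induced_graph gA /induced_graph gC.
  by apply: inducedP; apply: (spannedD gA gC).
- by move=> a A /induced_graph gA; apply: inducedP; apply: (spannedZ a gA).
- move=> A C /induced_graph gA /induced_graph gC.
  by apply: inducedP; apply: (spannedM prels gA gC).
Qed.

Lemma induced_gens :
  [/\ induced (op_e d) = x, induced (op_f d) = y & induced (op_H d) = h].
Proof.
split; apply: inducedP.
- exact: (spanned_x prels).
- exact: (spanned_y prels).
- exact: (spanned_h prels).
Qed.

End InducedMorphism.

Lemma schur_hom_eq d (B : algType rat) (phi psi : 'M[rat]_(2 ^ d) -> B) :
  schur_hom phi -> schur_hom psi ->
  phi (op_e d) = psi (op_e d) -> phi (op_f d) = psi (op_f d) ->
  phi (op_H d) = psi (op_H d) ->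
  forall A, in_schur A -> phi A = psi A.
Proof.
case=> p1 pD pZ pM [q1 qD qZ qM] Ee Ef EH A /schurP sA.
have [S0 SD SZ] := schur_subspace d.
suff [] : in_schur A /\ phi A = psi A by [].
(* Membership in S(2,d) is carried along because the morphism laws hold only there. *)
pose Q (C : tensor_end d) := in_schur C /\ phi C = psi C.
have QM C C' : Q C -> Q C' -> Q (C * C').
  move=> [sC eC] [sC' eC']; split; first exact: schurM.
  by rewrite pM // qM // eC eC'.
have Q1 : Q 1 by split; [exact: schur1 | rewrite p1 q1].
have QX C n : Q C -> Q (C ^+ n).
  by move=> QC; elim: n => [|n IH] //; rewrite exprS; apply: QM.
have QZ a C : Q C -> Q (a *: C).
  by move=> [sC eC]; split; [exact: SZ | rewrite pZ // qZ // eC].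
apply: (spanned_ind (P := Q) _ _ _ _ sA).
- by rewrite -(scale0r 1); apply: QZ.
- by move=> u v [su eu] [sv ev]; split; [exact: SD | rewrite pD // qD // eu ev].
- exact: QZ.
move=> a b c _; apply: (QM); first apply: (QM); apply: QX; split=> //.
- exact: schur_op_f.
- exact: schur_op_H.
- exact: schur_op_e.
Qed.

Theorem theorem2p3 (d : nat) :
  exists e f H : 'M[rat]_(2 ^ d),
    [/\ (* generators lie in S(2,d) and satisfy the relations *)
        [/\ in_schur e, in_schur f, in_schur H & mx_rels e f H],
        (* universal property: S(2,d) is the algebra presented by e,f,H
           and the relations (existence of the induced morphism) *)
        (forall (B : algType rat) (x y h : B), alg_rels d x y h ->
           exists phi : 'M[rat]_(2 ^ d) -> B,
             [/\ schur_hom phi, phi e = x, phi f = y & phi H = h]),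
        (* uniqueness of the induced morphism *)
        (forall (B : algType rat) (phi psi : 'M[rat]_(2 ^ d) -> B),
           schur_hom phi -> schur_hom psi ->
           phi e = psi e -> phi f = psi f -> phi H = psi H ->
           forall A, in_schur A -> phi A = psi A),
        (* the monomials f^a H^b e^c, a+b+c <= d, span S(2,d) ... *)
        (forall A, in_schur A <-> exists k, A = mono_comb e f H k) &
        (* ... and are linearly independent *)
        (forall k, mono_comb e f H k = 0 ->
           forall a b c : 'I_d.+1, (a + b + c <= d)%N -> k a b c = 0)].
Proof.
exists (op_e d), (op_f d), (op_H d); split.
- split; [exact: schur_op_e | exact: schur_op_f | exact: schur_op_H |].
  exact/mx_relsP/op_rels.
- move=> B x y h rels; exists (induced x y h).
  by have [] := induced_gens rels; split=> //; apply: induced_hom.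
- exact: schur_hom_eq.
- move=> A; rewrite schurP; split=> -[k ->]; exists k; by rewrite mono_combE.
- by move=> k; rewrite mono_combE => k0 a b c; apply: acomb_op_eq0.
Qed.
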